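(* For every $N \in \mathbb{N}$ there exists a free-by-cyclic group $G$ whose profinite genus relative to the class of all free-by-cyclic groups has cardinality larger than $N$.
   Context: A group is called free-by-cyclic if it is isomorphic to $F_n \rtimes \mathbb{Z}$ for some finitely generated free group $F_n$ and some action of $\mathbb{Z}$ on $F_n$. $\widehat{G}$ denotes the profinite completion of $G$, i.e. the inverse limit of the inverse system of finite quotients of $G$. The profinite genus of a free-by-cyclic group $G$ relative to the class of all free-by-cyclic groups is the set of isomorphism classes of free-by-cyclic groups $H$ with $\widehat{H} \cong \widehat{G}$. *)

(* Defs.v *)
From HB Require Import structures.
From mathcomp Require Import all_boot all_algebra.
From mathcomp Require Import all_classical topology.

Set Implicit Arguments.
Unset Strict Implicit.
Unset Printing Implicit Defensive.

Import GRing.Theory.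
Local Open Scope classical_set_scope.
Local Open Scope card_scope.
Local Open Scope group_scope.

Definition isomorphic (G H : groupType) : Prop :=
  exists f : {multiplicative G -> H}, bijective f.

(* [x] is a free basis of [F], by the universal property. *)
Definition free_of_rank (n : nat) (F : groupType) : Prop :=
  exists x : 'I_n -> F, forall (H : groupType) (h : 'I_n -> H),
    exists! f : F -> H, {morph f : u v / u * v} /\ (forall i, f (x i) = h i).

(* Actions of the additive group of [int] on [F] by group automorphisms; the
   inverse of [zact a k] is [zact a (- k)]. *)
Record zaction (F : groupType) := ZAction {
  zact :> int -> F -> F;
  zactM : forall k, {morph zact k : u v / u * v};
  zact0 : forall u, zact 0%R u = u;
  zactD : forall k l u, zact (k + l)%R u = zact k (zact l u)
}.

Definition semidirect (F : groupType) (a : zaction F) : Type := (F * int)%type.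

Section Semidirect.
Variables (F : groupType) (a : zaction F).
Local Notation S := (semidirect a).

HB.instance Definition _ := Choice.copy S (F * int)%type.

Definition semidirect_mul (p q : S) : S := (p.1 * a p.2 q.1, (p.2 + q.2)%R).
Definition semidirect_one : S := (1, 0%R).
Definition semidirect_inv (p : S) : S := (a (- p.2)%R p.1^-1, (- p.2)%R).

Lemma zact1 k : a k 1 = 1.
Proof. by apply: (mulgI (a k 1)); rewrite -zactM !mulg1. Qed.

Lemma semidirect_mulA : associative semidirect_mul.
Proof.
move=> [u k] [v l] [w m].
by rewrite /semidirect_mul /= zactM zactD mulgA addrA.
Qed.

Lemma semidirect_mul1 : left_id semidirect_one semidirect_mul.
Proof. by case=> u k; rewrite /semidirect_mul /= zact0 mul1g add0r. Qed.

Lemma semidirect_mulr1 : right_id semidirect_one semidirect_mul.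
Proof. by case=> u k; rewrite /semidirect_mul /= zact1 mulg1 addr0. Qed.

Lemma semidirect_mulV :
  left_inverse semidirect_one semidirect_inv semidirect_mul.
Proof.
case=> u k.
by rewrite /semidirect_mul /semidirect_inv /= -zactM mulVg zact1 addNr.
Qed.

Lemma semidirect_mulrV :
  right_inverse semidirect_one semidirect_inv semidirect_mul.
Proof.
case=> u k; rewrite /semidirect_mul /semidirect_inv /= -zactD subrr.
by rewrite zact0 mulgV.
Qed.

HB.instance Definition _ := isGroup.Build S semidirect_mulA semidirect_mul1
  semidirect_mulr1 semidirect_mulV semidirect_mulrV.

End Semidirect.

Definition free_by_cyclic (G : groupType) : Prop :=
  exists (n : nat) (F : groupType) (a : zaction F),
    free_of_rank n F /\ isomorphic G (semidirect a).

(* The carrier is not typed as [{pred G}] (via the coercion below it behaves as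
   such): the universe of [pred] is so large that, after [finiteQuotient] is used
   as an index type, [mathcomp.field] could no longer be loaded. *)
Record normalSubgroup (G : groupType) := NormalSubgroup {
  nsub : G -> bool;
  nsub_closed : group_closed (nsub : {pred G});
  nsub_normal : forall x g : G, nsub x -> nsub (x ^ g)
}.

Coercion nsub_pred (G : groupType) (N : normalSubgroup G) : {pred G} := nsub N.

Section Quotient.
Variables (G : groupType) (N : normalSubgroup G).

Definition coset_rel (x y : G) : bool := x^-1 * y \in N.

Let N1 : 1 \in N := (nsub_closed N).1.
Let NV x : x \in N -> x^-1 \in N.
Proof. by move=> Nx; rewrite -[x^-1]mul1g; apply: (nsub_closed N).2. Qed.
Let NM x y : x \in N -> y \in N -> x * y \in N.
Proof. by move=> Nx Ny; rewrite -[y]invgK; apply/(nsub_closed N).2/NV. Qed.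

Lemma coset_rel_refl : reflexive coset_rel.
Proof. by move=> x; rewrite /coset_rel mulVg. Qed.

Lemma coset_rel_sym : symmetric coset_rel.
Proof.
move=> x y; rewrite /coset_rel.
by apply/idP/idP => /NV; rewrite invgM invgK.
Qed.

Lemma coset_rel_trans : transitive coset_rel.
Proof.
move=> y x z /NM xy /xy; rewrite /coset_rel.
by rewrite mulgA -(mulgA x^-1) mulgV mulg1.
Qed.

Canonical coset_equiv :=
  EquivRel coset_rel coset_rel_refl coset_rel_sym coset_rel_trans.

Local Open Scope quotient_scope.

Definition coset_group := {eq_quot coset_equiv}.
HB.instance Definition _ := Choice.on coset_group.
HB.instance Definition _ := EqQuotient.on coset_group.

Lemma quotientP (x y : G) :
  reflect (\pi_coset_group x = \pi_coset_group y) (x^-1 * y \in N).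
Proof. exact: (@eqmodP G coset_equiv). Qed.

Definition quotient_mul : coset_group -> coset_group -> coset_group :=
  lift_op2 coset_group (fun x y : G => x * y).
Definition quotient_inv : coset_group -> coset_group :=
  lift_op1 coset_group (fun x : G => x^-1).
Definition quotient_one : coset_group := \pi_coset_group 1.

Lemma pi_mul x y :
  quotient_mul (\pi_coset_group x) (\pi_coset_group y) = \pi_coset_group (x * y).
Proof.
rewrite /quotient_mul; unlock; apply/quotientP.
have /quotientP Hx : \pi_coset_group (repr (\pi_coset_group x)) = \pi_coset_group x.
  by rewrite reprK.
have /quotientP Hy : \pi_coset_group (repr (\pi_coset_group y)) = \pi_coset_group y.
  by rewrite reprK.
move: (repr (\pi_coset_group x)) (repr (\pi_coset_group y)) Hx Hy => x' y' Hx Hy.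
have -> : (x' * y')^-1 * (x * y) = (x'^-1 * x) ^ y' * (y'^-1 * y).
  by rewrite invgM /conjg !mulgA mulgK.
by apply: NM => //; apply: nsub_normal.
Qed.

Lemma pi_inv x : quotient_inv (\pi_coset_group x) = \pi_coset_group x^-1.
Proof.
rewrite /quotient_inv; unlock; apply/quotientP.
have /quotientP Hx : \pi_coset_group (repr (\pi_coset_group x)) = \pi_coset_group x.
  by rewrite reprK.
move: (repr _) Hx => x' /NV /(nsub_normal x'^-1).
by rewrite /conjg invgM !invgK -mulgA mulgV mulg1.
Qed.

Lemma quotient_mulA : associative quotient_mul.
Proof.
by move=> x y z; rewrite -[x]reprK -[y]reprK -[z]reprK !pi_mul mulgA.
Qed.
Lemma quotient_mul1 : left_id quotient_one quotient_mul.
Proof. by move=> x; rewrite -[x]reprK pi_mul mul1g. Qed.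
Lemma quotient_mulr1 : right_id quotient_one quotient_mul.
Proof. by move=> x; rewrite -[x]reprK pi_mul mulg1. Qed.
Lemma quotient_mulV : left_inverse quotient_one quotient_inv quotient_mul.
Proof. by move=> x; rewrite -[x]reprK pi_inv pi_mul mulVg. Qed.
Lemma quotient_mulrV : right_inverse quotient_one quotient_inv quotient_mul.
Proof. by move=> x; rewrite -[x]reprK pi_inv pi_mul mulgV. Qed.

HB.instance Definition _ := isGroup.Build coset_group quotient_mulA quotient_mul1
  quotient_mulr1 quotient_mulV quotient_mulrV.

Lemma pi_mulg x y :
  \pi_coset_group x * \pi_coset_group y = \pi_coset_group (x * y) :> coset_group.
Proof. exact: pi_mul. Qed.
Lemma pi_invg x : (\pi_coset_group x)^-1 = \pi_coset_group x^-1 :> coset_group.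
Proof. exact: pi_inv. Qed.

End Quotient.

Record finiteQuotient (G : groupType) := FiniteQuotient {
  fq_kernel :> normalSubgroup G;
  fq_finite_index : finite_set [set: coset_group fq_kernel]
}.

HB.instance Definition _ (G : groupType) := gen_eqMixin (finiteQuotient G).
HB.instance Definition _ (G : groupType) := gen_choiceMixin (finiteQuotient G).

Section Completion.
Variable G : groupType.
Local Open Scope quotient_scope.

(* The natural map [G / N -> G / M], meaningful when [N] is contained in [M]. *)
Definition transition (N M : finiteQuotient G) (c : coset_group N) : coset_group M :=
  \pi_(coset_group M) (repr c).

Lemma transition_pi (N M : finiteQuotient G) (x : G) : {subset N <= M} ->
  @transition N M (\pi_(coset_group N) x) = \pi_(coset_group M) x.
Proof.
by move=> NM; apply/quotientP/NM/quotientP; rewrite reprK.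
Qed.

Lemma transition_mul (N M : finiteQuotient G) : {subset N <= M} ->
  {morph @transition N M : c d / c * d}.
Proof.
move=> NM c d; rewrite -[c]reprK -[d]reprK.
by rewrite pi_mulg !transition_pi // pi_mulg.
Qed.

Lemma transition_inv (N M : finiteQuotient G) : {subset N <= M} ->
  {morph @transition N M : c / c^-1}.
Proof.
move=> NM c; rewrite -[c]reprK.
by rewrite pi_invg !transition_pi // pi_invg.
Qed.

Definition quotient_family : Type :=
  prod_topology
    (fun N : finiteQuotient G => discrete_topology (coset_group N)).

HB.instance Definition _ := Topological.on quotient_family.

Definition compatible_family : set quotient_family :=
  [set x | forall N M : finiteQuotient G, {subset N <= M} ->
     @transition N M (x N) = x M].

Definition profinite_completion : Type := set_type compatible_family.

(* The subspace topology induced by the product of the discrete finite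
   quotients. *)
HB.instance Definition _ := Topological.on profinite_completion.

Lemma completion_mul_subproof (x y : profinite_completion) :
  ((fun N => (val x N : coset_group N) * val y N) : quotient_family) \in compatible_family.
Proof.
rewrite inE => N M NM.
have /set_mem/(_ _ _ NM) <- := valP x; have /set_mem/(_ _ _ NM) <- := valP y.
exact: transition_mul.
Qed.

Lemma completion_one_subproof :
  ((fun N => 1 : coset_group N) : quotient_family) \in compatible_family.
Proof. by rewrite inE => N M; exact: transition_pi. Qed.

Lemma completion_inv_subproof (x : profinite_completion) :
  ((fun N => (val x N : coset_group N)^-1) : quotient_family) \in compatible_family.
Proof.
rewrite inE => N M NM; have /set_mem/(_ _ _ NM) <- := valP x.
exact: transition_inv.
Qed.

Definition completion_mul (x y : profinite_completion) : profinite_completion :=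
  @exist quotient_family (fun x => x \in compatible_family) _ (completion_mul_subproof x y).
Definition completion_one : profinite_completion :=
  @exist quotient_family (fun x => x \in compatible_family) _ completion_one_subproof.
Definition completion_inv (x : profinite_completion) : profinite_completion :=
  @exist quotient_family (fun x => x \in compatible_family) _ (completion_inv_subproof x).

Lemma completion_mulA : associative completion_mul.
Proof. by move=> x y z; apply/val_inj/functional_extensionality_dep => N /=; rewrite mulgA. Qed.
Lemma completion_mul1 : left_id completion_one completion_mul.
Proof. by move=> x; apply/val_inj/functional_extensionality_dep => N /=; rewrite mul1g. Qed.
Lemma completion_mulr1 : right_id completion_one completion_mul.
Proof. by move=> x; apply/val_inj/functional_extensionality_dep => N /=; rewrite mulg1. Qed.
Lemma completion_mulV :
  left_inverse completion_one completion_inv completion_mul.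
Proof. by move=> x; apply/val_inj/functional_extensionality_dep => N /=; rewrite mulVg. Qed.
Lemma completion_mulrV :
  right_inverse completion_one completion_inv completion_mul.
Proof. by move=> x; apply/val_inj/functional_extensionality_dep => N /=; rewrite mulgV. Qed.

HB.instance Definition _ := isGroup.Build profinite_completion completion_mulA
  completion_mul1 completion_mulr1 completion_mulV completion_mulrV.

End Completion.

Definition profinitely_isomorphic (G H : groupType) : Prop :=
  exists f : {multiplicative profinite_completion G -> profinite_completion H},
  exists g : profinite_completion H -> profinite_completion G,
    [/\ cancel f g, cancel g f, continuous f & continuous g].

(* The genus is a collection of isomorphism classes, an isomorphism class being
   the predicate [isomorphic H] on all groups. [classical_sets.set] cannot be
   used here: [set groupType] is universe-inconsistent. *)
Definition profinite_genus (G : groupType) (C : groupType -> Prop) : Prop :=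
  exists H : groupType,
    [/\ free_by_cyclic H, profinitely_isomorphic H G & C = isomorphic H].

(* The cardinality, possibly infinite, of the collection [S] is larger than [n],
   i.e. at least [n + 1]. *)
Definition card_larger_than (n : nat) (T : Type) (S : T -> Prop) : Prop :=
  exists c : 'I_n.+1 -> T, injective c /\ forall i, S (c i).

(* Main.v *)
From HB Require Import structures.
Require Import Defs.
From mathcomp Require Import all_boot all_algebra.
From mathcomp Require Import all_classical topology.
From mathcomp Require Import zify ring.

Set Implicit Arguments.
Unset Strict Implicit.
Unset Printing Implicit Defensive.

Import GRing.Theory.
Local Open Scope group_scope.

(** For coprime positive [a] and [b] consider the group
      G(a) = < y, x, w, s | [y, x] = [x, w] = [x^a w^b, s] = 1 >,
    three copies of Z^2 glued in a row: <y, x> and <x, w> along <x>, then <x, w>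
    and <x^a w^b, s> along <x^a w^b>.  With [b] fixed, the groups G(a) with [a]
    prime to [b] all have the same profinite completion, and G(a), G(a') are
    isomorphic only if a' is congruent to a or to its inverse, up to sign,
    modulo [b].  A large prime [b] and a = 1, ..., N + 1 give the theorem.

    Fibration ([tubular_free_by_cyclic], [tubular_groupP]).  The homomorphism to
    Z sending [x] to 1 and [y], [w], [s] to 0 is injective on both edge groups,
    so its kernel is free; a basis is [y], [w] and s_k = x^k s x^-k for k < a.
    Conversely the mapping torus of the automorphism s_k -> s_{k+1},
    s_{a-1} -> w^-b s_0 w^b of this free group is G(a).

    Completions ([profinitely_isomorphic_of_transfer],
    [tubular_profinitely_isomorphic]).  The only invariant of the gluing is the
    position of the two lines <x> and <x^a w^b> in Z^2.  Over the profinite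
    integers [x] may be rescaled by a unit K, so all these positions are
    equivalent: (y, x, w, s) -> (y, x^K, w x^C, s) with K + b C = a turns
    solutions of the relations of G(a) in a finite group into solutions of the
    relations of G(1), bijectively and naturally.  A natural bijection between
    homomorphisms to finite groups is an isomorphism of completions.

    Isomorphisms ([commuting_coordinates], [large_centralizer_line],
    [tubular_isomorphic]).  Over Z the two lines are visible in the
    abelianization Z^4 of G(a): a commuting pair of elements is annihilated by
    three alternating forms, obtained from homomorphisms to the Heisenberg
    group, and the only vectors with a centralizer of rank at least 3 for these
    forms lie on the lines of [x] and of v = x^a w^b.  An isomorphism therefore
    maps {x, v} to {x', v'} up to signs and order, while v - a x is divisible by
    [b]; this determines [a] modulo [b] up to sign and inversion. *)

Local Notation "{ 'hom' G -> H }" := (UMagmaMorphism.type G H)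
  (at level 0, G at level 98, format "{ 'hom'  G  ->  H }") : type_scope.

Lemma hom_of_morph (G H : groupType) (f : G -> H) :
  {morph f : u v / u * v} -> exists f' : {hom G -> H}, f = f' :> (G -> H).
Proof.
move=> fM; have f1 : f 1 = 1 by apply: (mulgI (f 1)); rewrite -fM !mulg1.
pose f' : {hom G -> H} := HB.pack f (isUMagmaMorphism.Build G H f (f1, fM)).
by exists f'.
Qed.

(** * Free groups *)

Section FreeGroup.
Variable n : nat.
Local Open Scope quotient_scope.

(** The boolean marks an inverse letter. *)
Definition word := seq ('I_n * bool).

Definition letter_value (H : groupType) (h : 'I_n -> H) (l : 'I_n * bool) : H :=
  if l.2 then (h l.1)^-1 else h l.1.

Definition word_value (H : groupType) (h : 'I_n -> H) (u : word) : H :=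
  \prod_(l <- u) letter_value h l.

(** Words are identified when no group separates them.  With this impredicative
    relation the universal property is built in and normal forms of words are
    never needed. *)
Definition word_equiv (u v : word) : bool :=
  `[< forall (H : groupType) (h : 'I_n -> H), word_value h u = word_value h v >].

Lemma word_equiv_refl : reflexive word_equiv.
Proof. by move=> u; apply/asboolP. Qed.

Lemma word_equiv_sym : symmetric word_equiv.
Proof. by move=> u v; apply/asboolP/asboolP => uv H h. Qed.

Lemma word_equiv_trans : transitive word_equiv.
Proof.
by move=> v u w /asboolP uv /asboolP vw; apply/asboolP => H h; rewrite uv.
Qed.

Canonical word_equivalence :=
  EquivRel word_equiv word_equiv_refl word_equiv_sym word_equiv_trans.

Definition free_group := {eq_quot word_equivalence}.
HB.instance Definition _ := Choice.on free_group.
HB.instance Definition _ := EqQuotient.on free_group.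

Definition free_eval (H : groupType) (h : 'I_n -> H) (u : free_group) : H :=
  word_value h (repr u).

Lemma free_eval_pi (H : groupType) (h : 'I_n -> H) (u : word) :
  free_eval h (\pi_free_group u) = word_value h u.
Proof.
have /eqmodP/asboolP : \pi_free_group (repr (\pi_free_group u)) = \pi_free_group u.
  by rewrite reprK.
exact.
Qed.

(** Evaluations separate the elements, so the group laws below are inherited
    from the target groups. *)
Lemma free_ext (u v : free_group) :
  (forall (H : groupType) (h : 'I_n -> H), free_eval h u = free_eval h v) -> u = v.
Proof.
by move=> uv; rewrite -[u]reprK -[v]reprK; apply/eqmodP/asboolP.
Qed.

Definition free_mul (u v : free_group) : free_group :=
  \pi_free_group (repr u ++ repr v).
Definition free_one : free_group := \pi_free_group [::].
Definition free_inv (u : free_group) : free_group :=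
  \pi_free_group (rev [seq (l.1, ~~ l.2) | l <- repr u]).

Lemma free_evalM (H : groupType) (h : 'I_n -> H) (u v : free_group) :
  free_eval h (free_mul u v) = free_eval h u * free_eval h v.
Proof. by rewrite free_eval_pi /word_value big_cat. Qed.

Lemma free_eval1 (H : groupType) (h : 'I_n -> H) : free_eval h free_one = 1.
Proof. by rewrite free_eval_pi /word_value big_nil. Qed.

Lemma free_evalV (H : groupType) (h : 'I_n -> H) (u : free_group) :
  free_eval h (free_inv u) = (free_eval h u)^-1.
Proof.
rewrite free_eval_pi /free_eval /word_value -[repr u in RHS]revK -prodgV.
rewrite -map_rev big_map.
by apply: eq_bigr => -[i []] _; rewrite /letter_value /= ?invgK.
Qed.

Lemma free_mulA : associative free_mul.
Proof. by move=> u v w; apply: free_ext => H h; rewrite !free_evalM mulgA. Qed.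
Lemma free_mul1 : left_id free_one free_mul.
Proof. by move=> u; apply: free_ext => H h; rewrite free_evalM free_eval1 mul1g. Qed.
Lemma free_mulr1 : right_id free_one free_mul.
Proof. by move=> u; apply: free_ext => H h; rewrite free_evalM free_eval1 mulg1. Qed.
Lemma free_mulV : left_inverse free_one free_inv free_mul.
Proof.
by move=> u; apply: free_ext => H h; rewrite free_evalM free_evalV free_eval1 mulVg.
Qed.
Lemma free_mulrV : right_inverse free_one free_inv free_mul.
Proof.
by move=> u; apply: free_ext => H h; rewrite free_evalM free_evalV free_eval1 mulgV.
Qed.

HB.instance Definition _ := isGroup.Build free_group free_mulA free_mul1
  free_mulr1 free_mulV free_mulrV.

HB.instance Definition _ (H : groupType) (h : 'I_n -> H) :=
  isUMagmaMorphism.Build free_group H (free_eval h)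
    (free_eval1 h, free_evalM h).

Definition free_gen (i : 'I_n) : free_group := \pi_free_group [:: (i, false)].

Lemma free_eval_gen (H : groupType) (h : 'I_n -> H) (i : 'I_n) :
  free_eval h (free_gen i) = h i.
Proof. by rewrite free_eval_pi /word_value big_seq1. Qed.

Lemma free_eval_id (u : free_group) : free_eval free_gen u = u.
Proof.
apply: free_ext => H h.
rewrite [free_eval (@free_gen) u]/free_eval /word_value (gmulf_prod (free_eval h)).
by apply: eq_bigr => -[i []] _; rewrite /letter_value /= ?gmulfV /= free_eval_gen.
Qed.

Lemma free_group_ind (P : free_group -> Prop) :
  P 1 -> (forall u v, P u -> P v -> P (u * v)) -> (forall u, P u -> P u^-1) ->
  (forall i, P (free_gen i)) -> forall u, P u.
Proof.
move=> P1 PM PV Pgen u; rewrite -[u]free_eval_id /free_eval /word_value.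
by apply: big_ind => // -[i []] _; rewrite /letter_value /=; auto.
Qed.

Lemma free_group_free : free_of_rank n free_group.
Proof.
exists free_gen => H h; exists (free_eval h); split.
  by split; [exact: free_evalM | exact: free_eval_gen].
move=> _ [/hom_of_morph[f ->] fgen]; apply/funext => u.
rewrite -[u in RHS]free_eval_id /free_eval /word_value gmulf_prod.
by apply: eq_bigr => -[i []] _; rewrite /letter_value /= ?gmulfV fgen.
Qed.

End FreeGroup.

(** * Mapping tori *)

Section IntegerExponents.

Definition zexp (H : groupType) (x : H) (k : int) : H :=
  match k with Posz n => x ^+ n | Negz n => x ^- n.+1 end.

Lemma zexpS (H : groupType) (x : H) k : zexp x (k + 1)%R = x * zexp x k.
Proof.
case: k => [n|[|n]]; first by rewrite addrC -intS /= expgS.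
  by rewrite /= mulgV.
have -> : (Negz n.+1 + 1)%R = Negz n by lia.
by rewrite /= [x ^+ n.+2]expgSr invgM mulVKg.
Qed.

Lemma zexpP (H : groupType) (x : H) k : zexp x (k - 1)%R = x^-1 * zexp x k.
Proof. by rewrite -[in RHS](subrK 1%R k) zexpS mulKg. Qed.

Lemma zexpD (H : groupType) (x : H) k l : zexp x (k + l)%R = zexp x k * zexp x l.
Proof.
elim/int_ind: k => [|k IH|k IH]; first by rewrite add0r mul1g.
  by rewrite intS [(1 + _)%R]addrC addrAC !zexpS IH mulgA.
by rewrite intS opprD [(- 1 + _)%R]addrC addrAC !zexpP IH mulgA.
Qed.

End IntegerExponents.

Section IteratedAction.
Variables (F : groupType) (phi psi : {hom F -> F}).
Hypotheses (phiK : cancel phi psi) (psiK : cancel psi phi).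

Definition iterz (k : int) : F -> F :=
  match k with Posz n => iter n phi | Negz n => iter n.+1 psi end.

Lemma iterzS k u : iterz (k + 1)%R u = phi (iterz k u).
Proof.
case: k => [n|[|n]]; first by rewrite addrC -intS.
  by rewrite /= psiK.
have -> : (Negz n.+1 + 1)%R = Negz n by lia.
by rewrite /= psiK.
Qed.

Lemma iterzP k u : iterz (k - 1)%R u = psi (iterz k u).
Proof. by rewrite -[in RHS](subrK 1%R k) iterzS phiK. Qed.

Lemma iterzD k l u : iterz (k + l)%R u = iterz k (iterz l u).
Proof.
elim/int_ind: k => [|k IH|k IH]; first by rewrite add0r.
  by rewrite intS [(1 + _)%R]addrC addrAC !iterzS IH.
by rewrite intS opprD [(- 1 + _)%R]addrC addrAC !iterzP IH.
Qed.

Lemma iterzM k : {morph iterz k : u v / u * v}.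
Proof.
move=> u v; elim/int_ind: k => [|k IH|k IH] //.
  by rewrite intS addrC !iterzS IH gmulfM.
by rewrite intS opprD addrC !iterzP IH gmulfM.
Qed.

Definition iter_action : zaction F := ZAction iterzM (fun u => erefl) iterzD.

Lemma iterz1 k : iterz k 1 = 1.
Proof. exact: (zact1 iter_action). Qed.

Local Notation S := (semidirect iter_action).

Lemma semidirectM (u v : F) (k l : int) :
  ((u, k) : S) * ((v, l) : S) = ((u * iterz k v, (k + l)%R) : S).
Proof. by []. Qed.

Lemma semidirectV (u : F) (k : int) :
  ((u, k) : S)^-1 = ((iterz (- k)%R u^-1, (- k)%R) : S).
Proof. by []. Qed.

Lemma semidirectX (u : F) m : ((u, 0%R) : S) ^+ m = ((u ^+ m, 0%R) : S).
Proof.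
by elim: m => [|m IH] //; rewrite !expgS IH semidirectM addr0.
Qed.

Lemma semidirect_stableX m : ((1, 1%R) : S) ^+ m = ((1, Posz m) : S).
Proof.
by elim: m => [|m IH] //; rewrite !expgS IH semidirectM iterz1 mulg1 -intS.
Qed.

Lemma semidirect_conj (u : F) :
  ((1, 1%R) : S) * ((u, 0%R) : S) * ((1, 1%R) : S)^-1 = ((phi u, 0%R) : S).
Proof.
apply: (mulIg ((1, 1%R) : S)); rewrite mulgVK !semidirectM.
by rewrite mul1g iterz1 mulg1 addr0 add0r.
Qed.

Lemma semidirect_ind (P : S -> Prop) :
  (forall g h, P g -> P h -> P (g * h)) -> (forall g, P g -> P g^-1) ->
  (forall u, P (u, 0%R)) -> P (1, 1%R) -> forall g, P g.
Proof.
move=> PM PV PF Pt [u k].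
have P1 : P 1 by exact: PF.
have Pk : P (1, k).
  have PX m : P (((1, 1%R) : S) ^+ m) by elim: m => [|m IH] //; rewrite expgS; apply: PM.
  have -> : ((1, k) : S) = zexp ((1, 1%R) : S) k.
    case: k => m; rewrite /zexp semidirect_stableX //.
    by rewrite semidirectV invg1 iterz1 NegzE.
  by case: k => m; rewrite /zexp; [exact: PX | apply/PV/PX].
by have -> : ((u, k) : S) = ((u, 0%R) : S) * ((1, k) : S);
  [rewrite semidirectM mulg1 add0r | exact: PM].
Qed.

(** The mapping torus is the free product of [F] and Z modulo the relations
    t u t^-1 = phi u, so a homomorphism is given by its restriction to the
    fibre and the image of the stable letter t. *)
Lemma semidirect_lift (H : groupType) (f : {hom F -> H}) (x : H) :
  (forall u, x * f u = f (phi u) * x) ->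
  exists g : {hom S -> H}, (forall u, g (u, 0%R) = f u) /\ g (1, 1%R) = x.
Proof.
move=> fx.
have fz k u : f (iterz k u) * zexp x k = zexp x k * f u.
  elim/int_ind: k => [|k IH|k IH]; first by rewrite /= mulg1 mul1g.
    by rewrite intS addrC iterzS zexpS mulgA -fx -!mulgA IH.
  rewrite intS opprD addrC iterzP zexpP.
  have -> : f (psi (iterz (- Posz k)%R u)) = x^-1 * f (iterz (- Posz k)%R u) * x.
    by apply: (mulgI x); rewrite fx psiK mulgA mulVKg.
  by rewrite -mulgA mulVKg -mulgA IH mulgA.
pose g (p : S) := f p.1 * zexp x p.2.
have [|g' gE] := @hom_of_morph S H g.
  move=> [u k] [v l]; rewrite semidirectM /g /= gmulfM zexpD.
  by rewrite -!mulgA; congr (_ * _); rewrite !mulgA fz.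
by exists g'; rewrite -gE /g /=; split=> [u|]; rewrite ?gmulf1 ?mulg1 ?mul1g.
Qed.

End IteratedAction.

(** * The groups G(a) and their fibrations *)

Definition tubular_relations (a b : nat) (H : groupType) (y x w s : H) : Prop :=
  [/\ commute y x, commute x w & commute (x ^+ a * w ^+ b) s].

(** The statement that [G] is presented by the four generators and the three
    relations: von Dyck's theorem, together with generation in the form of an
    induction principle. *)
Record tubular_presentation (a b : nat) (G : groupType) (y x w s : G) : Prop := {
  tubular_rel : tubular_relations a b y x w s;
  tubular_lift : forall (H : groupType) (y' x' w' s' : H),
    tubular_relations a b y' x' w' s' ->
    exists f : {hom G -> H}, [/\ f y = y', f x = x', f w = w' & f s = s'];
  tubular_ind : forall P : G -> Prop,
    P 1 -> (forall g h, P g -> P h -> P (g * h)) -> (forall g, P g -> P g^-1) ->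
    P y -> P x -> P w -> P s -> forall g, P g
}.

Section TubularGroup.
Variables (a b : nat).
Hypothesis a_gt0 : 0 < a.

Local Notation F := (free_group a.+2).

(** The two values [y], [w] followed by [s 0, ..., s (a - 1)]: basis elements
    of the fibre, where [s k] stands for x^k s x^-k. *)
Definition fibre_basis (H : Type) (y w : H) (s : nat -> H) (i : 'I_a.+2) : H :=
  match val i with 0 => y | 1 => w | k.+2 => s k end.

Let Y : F := free_gen (inord 0).
Let W : F := free_gen (inord 1).
Let S k : F := free_gen (inord k.+2).

Lemma eval_Y (H : groupType) (y w : H) s : free_eval (fibre_basis y w s) Y = y.
Proof. by rewrite free_eval_gen /fibre_basis /= inordK. Qed.
Lemma eval_W (H : groupType) (y w : H) s : free_eval (fibre_basis y w s) W = w.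
Proof. by rewrite free_eval_gen /fibre_basis /= inordK. Qed.
Lemma eval_S (H : groupType) (y w : H) s k :
  k < a -> free_eval (fibre_basis y w s) (S k) = s k.
Proof. by move=> ka; rewrite free_eval_gen /fibre_basis /= inordK. Qed.

Lemma fibre_ind (P : F -> Prop) :
  P 1 -> (forall u v, P u -> P v -> P (u * v)) -> (forall u, P u -> P u^-1) ->
  P Y -> P W -> (forall k, k < a -> P (S k)) -> forall u, P u.
Proof.
move=> P1 PM PV PY PW PS; apply: free_group_ind => // i.
rewrite -(inord_val i); case: i => -[|[|k]] //= ka.
exact: PS.
Qed.

Lemma hom_fibre_ext (H : groupType) (f g : {hom F -> H}) :
  f Y = g Y -> f W = g W -> (forall k, k < a -> f (S k) = g (S k)) -> f =1 g.
Proof.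
move=> fY fW fS; apply: fibre_ind => // [|u v fu fv|u fu].
- by rewrite !gmulf1.
- by rewrite !gmulfM fu fv.
- by rewrite !gmulfV fu.
Qed.

(** Conjugation by [x].  Since x^a w^b commutes with [s], the element
    x^a s x^-a equals w^-b s w^b, which closes the chain of conjugates. *)
Definition monodromy : {hom F -> F} :=
  free_eval (fibre_basis Y W
    (fun k => if k.+1 < a then S k.+1 else S 0 ^ (W ^+ b))).

Definition monodromy_inv : {hom F -> F} :=
  free_eval (fibre_basis Y W
    (fun k => if k is k'.+1 then S k' else S a.-1 ^ (W ^- b))).

Lemma monodromyK : cancel monodromy monodromy_inv.
Proof.
apply: (@hom_fibre_ext _ (monodromy_inv \o monodromy) idfun) => /=.
- by rewrite !eval_Y.
- by rewrite !eval_W.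
move=> k ka; rewrite eval_S //; case: ltnP => ka'; first by rewrite eval_S.
rewrite gmulfJ gmulfXn /= eval_W eval_S // -conjgM mulVg conjg1.
by congr S; lia.
Qed.

Lemma monodromy_invK : cancel monodromy_inv monodromy.
Proof.
apply: (@hom_fibre_ext _ (monodromy \o monodromy_inv) idfun) => /=.
- by rewrite !eval_Y.
- by rewrite !eval_W.
move=> k ka; rewrite eval_S //; case: k ka => [_|k ka].
  rewrite gmulfJ gmulfV gmulfXn /= eval_W eval_S ?prednK // ltnn.
  by rewrite -conjgM mulgV conjg1.
by rewrite eval_S ?(ltnW ka) // ka.
Qed.

Definition tubular_group : groupType :=
  semidirect (iter_action monodromyK monodromy_invK).

Lemma tubular_free_by_cyclic : free_by_cyclic tubular_group.
Proof.
exists a.+2, F, (iter_action monodromyK monodromy_invK).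
split; first exact: free_group_free.
by exists idfun; exists idfun.
Qed.

Lemma iter_monodromy_S k : k < a -> iter k monodromy (S 0) = S k.
Proof.
elim: k => [|k IH] // ka; rewrite iterS IH ?(ltnW ka) //.
by rewrite /monodromy /= eval_S ?(ltnW ka) // ka.
Qed.

Lemma tubular_groupP :
  tubular_presentation a b ((Y, 0%R) : tubular_group) ((1, 1%R) : tubular_group)
    ((W, 0%R) : tubular_group) ((S 0, 0%R) : tubular_group).
Proof.
have phiY : monodromy Y = Y by rewrite /monodromy /= eval_Y.
have phiW : monodromy W = W by rewrite /monodromy /= eval_W.
split.
- split; rewrite /commute.
  + by rewrite !semidirectM !mulg1 /= mul1g phiY addr0 add0r.
  + by rewrite !semidirectM !mulg1 /= mul1g phiW addr0 add0r.
  rewrite semidirect_stableX semidirectX !semidirectM mul1g.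
  have phiX k : iter k monodromy (W ^+ b) = W ^+ b.
    by elim: k => // k IH; rewrite iterS IH gmulfXn phiW.
  have phiS : iter a monodromy (S 0) = S 0 ^ (W ^+ b).
    transitivity (iter a.-1.+1 monodromy (S 0)); first by congr iter; lia.
    rewrite iterS iter_monodromy_S ?prednK //.
    by rewrite /monodromy /= eval_S ?prednK // ltnn.
  rewrite !addr0 !add0r.
  transitivity ((iter a monodromy (W ^+ b) * iter a monodromy (S 0), Posz a)) => //.
  rewrite phiS phiX /conjg mulVKg.
  transitivity ((S 0 * iter a monodromy (W ^+ b), Posz a)) => //.
  by rewrite phiX.
- move=> H y x w s [yx xw vs].
  pose c k := s ^ (x ^- k).
  have [|g [gF gt]] := @semidirect_lift _ _ _ monodromyK monodromy_invK H
    (free_eval (fibre_basis y w c)) x.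
    apply: fibre_ind => [|u v fu fv|u fu|||k ka] /=.
    + by rewrite !gmulf1 mulg1 mul1g.
    + by rewrite !gmulfM mulgA fu -mulgA fv mulgA.
    + rewrite !gmulfV; apply: (mulgI (free_eval (fibre_basis y w c) (monodromy u))).
      by rewrite mulgA -fu mulVKg mulgK.
    + by rewrite phiY eval_Y.
    + by rewrite phiW eval_W.
    rewrite [in RHS]eval_S // eval_S // /c.
    have cS j : s ^ (x ^- j.+1) * x = x * s ^ (x ^- j).
      by rewrite !conjgE !invgK expgS invgM !mulgA mulgVK.
    case: ltnP => [ka'|ka']; first by rewrite eval_S // cS.
    rewrite -cS; congr (_ * _).
    have -> : k.+1 = a by apply/eqP; rewrite eqn_leq ka ka'.
    rewrite gmulfJ gmulfXn /= eval_W eval_S // /c expg0 invg1 conjg1.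
    rewrite !conjgE invgK.
    apply: (mulgI (w ^+ b)); apply: (mulIg (x ^+ a)).
    have xwab : commute (x ^+ a) (w ^+ b) by apply: commuteX2.
    by rewrite !mulgA mulgVK mulgV mul1g -xwab vs xwab mulgA.
  exists g; split=> //; rewrite gF /=; [exact: eval_Y|exact: eval_W|].
  by rewrite eval_S // /c invg1 conjg1.
- move=> P P1 PM PV PY Px PW PS; apply: semidirect_ind => //.
  apply: (@fibre_ind (fun u => P (u, 0%R))) => //.
  + by move=> u v Pu Pv; have := PM _ _ Pu Pv; rewrite semidirectM addr0.
  + by move=> u /PV; rewrite semidirectV oppr0.
  elim=> [|k IH] ka //.
  have := PM _ _ (PM _ _ Px (IH (ltnW ka))) (PV _ Px).
  by rewrite semidirect_conj /= eval_S ?(ltnW ka) // ka.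
Qed.

End TubularGroup.

(** * Isomorphisms of profinite completions *)

Section Completion.
Local Open Scope quotient_scope.
Local Open Scope classical_set_scope.

Definition finite_group (Q : groupType) : Prop := finite_set [set: Q].

Section Kernel.
Variables (G Q : groupType) (finQ : finite_group Q) (p : {hom G -> Q}).

Definition hom_kernel (g : G) : bool := p g == 1.

Lemma hom_kernel_closed : group_closed (hom_kernel : {pred G}).
Proof.
rewrite /hom_kernel; split=> [|u v]; rewrite -!topredE /= ?gmulf1 // => /eqP pu /eqP pv.
by rewrite gmulfF pu pv divg1.
Qed.

Lemma hom_kernel_normal (u g : G) : hom_kernel u -> hom_kernel (u ^ g).
Proof. by rewrite /hom_kernel gmulfJ => /eqP ->; rewrite conj1g. Qed.

Definition kernel_subgroup := NormalSubgroup hom_kernel_closed hom_kernel_normal.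

Lemma kernelP (g h : G) :
  reflect (p g = p h) (g^-1 * h \in (kernel_subgroup : {pred G})).
Proof.
rewrite -topredE /= /hom_kernel gmulfM gmulfV.
apply: (iffP eqP) => [pgh|->]; last by rewrite mulVg.
by apply: (mulgI (p g)^-1); rewrite pgh mulVg.
Qed.

Lemma kernel_finite_index : finite_set [set: coset_group kernel_subgroup].
Proof.
rewrite -[setT](preimage_setT (fun c : coset_group kernel_subgroup => p (repr c))).
apply: finite_preimage => // c d _ _ cd.
by rewrite -[c]reprK -[d]reprK; apply/quotientP/kernelP.
Qed.

Definition kernel_quotient := FiniteQuotient kernel_finite_index.

(** The extension of [p] to the completion: a compatible family determines an
    element of the image of [p] through its coordinate at the kernel. *)
Definition completion_eval (xi : profinite_completion G) : Q :=
  p (repr (val xi kernel_quotient : coset_group kernel_quotient)).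

(** Any coordinate through which [p] factors gives the same value, by
    compatibility of the family. *)
Lemma completion_evalE (N : finiteQuotient G) (xi : profinite_completion G) :
  (forall g, g \in (N : {pred G}) -> p g = 1) ->
  completion_eval xi = p (repr (val xi N : coset_group N)).
Proof.
move=> Np; have NK : {subset (N : {pred G}) <= (kernel_quotient : {pred G})}.
  by move=> g /Np pg; rewrite -topredE /= /hom_kernel pg.
rewrite /completion_eval; have /set_mem/(_ _ _ NK) <- := valP xi.
by apply/kernelP/quotientP; rewrite reprK.
Qed.

End Kernel.

Section Quotients.
Variable G : groupType.

Definition quotient_hom (N : finiteQuotient G) : {hom G -> coset_group N} :=
  let f : G -> coset_group N := \pi_(coset_group N) in
  HB.pack f (isUMagmaMorphism.Build G (coset_group N) f
    (erefl, fun g h => esym (pi_mulg N g h))).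

Lemma quotient_homE (N : finiteQuotient G) (g : G) :
  quotient_hom N g = \pi_(coset_group N) g.
Proof. by []. Qed.

Lemma quotient_hom1 (N : finiteQuotient G) (g : G) :
  g \in (N : {pred G}) -> quotient_hom N g = 1.
Proof.
move=> Ng; apply/esym/(quotientP N 1 g).
by rewrite invg1 mul1g.
Qed.

Lemma quotient_factor (Q : groupType) (p : {hom G -> Q}) (N : finiteQuotient G) :
  (forall g, g \in (N : {pred G}) -> p g = 1) ->
  exists q : {hom coset_group N -> Q},
    (forall c, q c = p (repr c)) /\ p =1 q \o quotient_hom N.
Proof.
move=> Np.
have pN g : p (repr (\pi_(coset_group N) g)) = p g.
  have : (repr (\pi_(coset_group N) g))^-1 * g \in (N : {pred G}).
    by apply/quotientP; rewrite reprK.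
  by move=> /Np; rewrite gmulfM gmulfV => /(canRL (mulKg _)); rewrite invgK mulg1.
have [|q qE] := @hom_of_morph (coset_group N) Q (fun c => p (repr c)).
  by move=> c d; rewrite -[c in LHS]reprK -[d in LHS]reprK pi_mulg pN gmulfM.
by exists q; rewrite -qE; split=> // g /=; rewrite pN.
Qed.

Lemma completion_eval_comp (Q R : groupType) (finQ : finite_group Q)
    (finR : finite_group R) (p : {hom G -> Q}) (q : {hom G -> R})
    (t : {hom Q -> R}) (xi : profinite_completion G) :
  q =1 t \o p -> completion_eval finR q xi = t (completion_eval finQ p xi).
Proof.
move=> qE; rewrite (@completion_evalE _ _ finR q (kernel_quotient finQ p)).
  by rewrite qE.
move=> g; rewrite -topredE /= /hom_kernel => /eqP pg.
by rewrite qE /= pg gmulf1.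
Qed.

Lemma completion_evalM (Q : groupType) (finQ : finite_group Q) (p : {hom G -> Q}) :
  {morph completion_eval finQ p : xi zeta / xi * zeta}.
Proof.
move=> xi zeta.
have [g|q [qE _]] := @quotient_factor Q p (kernel_quotient finQ p).
  by rewrite -topredE /= /hom_kernel => /eqP.
by rewrite /completion_eval -!qE -gmulfM.
Qed.

Lemma completion_eval_quotient (N : finiteQuotient G)
    (finN : finite_group (coset_group N)) (xi : profinite_completion G) :
  completion_eval finN (quotient_hom N) xi = val xi N.
Proof.
by rewrite (completion_evalE finN xi (@quotient_hom1 N)) quotient_homE reprK.
Qed.

Lemma completion_nbhs (N : finiteQuotient G) (xi : profinite_completion G) :
  nbhs xi [set zeta : profinite_completion G | val zeta N = val xi N].
Proof.
pose level (x : quotient_family G) : discrete_topology (coset_group N) := x N.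
have cont : continuous (level \o (val : profinite_completion G -> quotient_family G)).
  move=> zeta; apply: continuous_comp.
    exact: (@initial_continuous _ (quotient_family G) set_val).
  pose K (M : finiteQuotient G) : topologicalType := discrete_topology (coset_group M).
  exact: (@proj_continuous _ K N).
by apply: (cont xi [set level (val xi)]); exact: discrete_set1.
Qed.

End Quotients.

(** A natural way of turning homomorphisms from [H] to finite groups into
    homomorphisms from [G] induces, as in the Yoneda lemma, a continuous map from
    the completion of [G] to that of [H]: the coordinate at [N] of the image is
    the value of the homomorphism obtained from the projection of [H] onto
    [H / N]. *)
Definition hom_transfer (G H : groupType) : Type :=
  forall Q : groupType, finite_group Q -> {hom H -> Q} -> {hom G -> Q}.

Definition natural_transfer (G H : groupType) (T : hom_transfer G H) : Prop :=
  forall (Q R : groupType) (finQ : finite_group Q) (finR : finite_group R)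
    (p : {hom H -> Q}) (q : {hom H -> R}) (t : {hom Q -> R}),
    q =1 t \o p -> T R finR q =1 t \o T Q finQ p.

Section Transfer.
Variables (G H : groupType) (T : hom_transfer G H).
Hypothesis T_nat : natural_transfer T.

Definition transfer_family (xi : profinite_completion G) : quotient_family H :=
  fun N => completion_eval (fq_finite_index N)
    (T (fq_finite_index N) (quotient_hom N)) xi.

Lemma transfer_compatible xi : transfer_family xi \in @compatible_family H.
Proof.
rewrite inE => N M NM; rewrite /transfer_family.
have [g /NM|t [tE tpi]] := @quotient_factor H _ (quotient_hom M) N.
  exact: quotient_hom1.
rewrite -[transition _ _]tE; apply/esym/completion_eval_comp.
exact: T_nat.
Qed.

Definition transfer (xi : profinite_completion G) : profinite_completion H :=
  @exist (quotient_family H) (fun x => x \in @compatible_family H) _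
    (transfer_compatible xi).

Lemma transferM : {morph transfer : xi zeta / xi * zeta}.
Proof.
move=> xi zeta; apply/val_inj/functional_extensionality_dep => N /=.
exact: completion_evalM.
Qed.

(** The defining property of [transfer] for the projections [H -> H / N] extends
    to all homomorphisms to finite groups, because each of them factors through
    such a projection and the transfer is natural. *)
Lemma transfer_eval (Q : groupType) (finQ : finite_group Q) (q : {hom H -> Q}) xi :
  completion_eval finQ q (transfer xi) = completion_eval finQ (T finQ q) xi.
Proof.
have [g|t [tE qE]] := @quotient_factor H Q q (kernel_quotient finQ q).
  by rewrite -topredE /= /hom_kernel => /eqP.
rewrite {1}/completion_eval -tE; apply/esym/completion_eval_comp.
exact: T_nat.
Qed.

(** Each coordinate of the image depends on one coordinate of the argument. *)
Lemma transfer_continuous : continuous transfer.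
Proof.
apply: continuous_comp_initial => xi.
have xi_filter : Filter ((set_val \o transfer) @ xi).
  exact: fmap_filter (nbhs_filter xi).
apply/cvg_sup => N U [?/= [[W oW <-]]] /= Wxi.
move=> /filterS; apply.
apply: filterS (completion_nbhs (kernel_quotient (fq_finite_index N)
    (T (fq_finite_index N) (quotient_hom N))) xi) => zeta zeta_xi.
have E : transfer_family zeta N = transfer_family xi N.
  by rewrite /transfer_family /completion_eval [val zeta _]zeta_xi.
have {}Wxi : W (transfer_family xi N) by [].
by rewrite -E in Wxi.
Qed.

End Transfer.

Lemma transferK (G H : groupType) (T : hom_transfer G H) (S : hom_transfer H G)
    (T_nat : natural_transfer T) (S_nat : natural_transfer S) :
  (forall (Q : groupType) finQ (q : {hom G -> Q}), T Q finQ (S Q finQ q) =1 q) ->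
  cancel (transfer T_nat) (transfer S_nat).
Proof.
move=> TS xi; apply/val_inj/functional_extensionality_dep => N /=.
rewrite /transfer_family transfer_eval.
rewrite -[RHS](completion_eval_quotient (fq_finite_index N)).
rewrite -[LHS]/(idfun _); apply/esym/completion_eval_comp => g.
by rewrite /= TS.
Qed.

(** The inverse of a natural bijection is natural, so it induces a continuous
    inverse. *)
Lemma profinitely_isomorphic_of_transfer (G H : groupType) (T : hom_transfer G H) :
  natural_transfer T ->
  (forall (Q : groupType) finQ (p q : {hom H -> Q}),
    T Q finQ p =1 T Q finQ q -> p =1 q) ->
  (forall (Q : groupType) finQ (q : {hom G -> Q}), exists p, T Q finQ p =1 q) ->
  profinitely_isomorphic H G.
Proof.
move=> T_nat T_inj T_surj.
pose S : hom_transfer H G := fun Q finQ q => sval (cid (T_surj Q finQ q)).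
have TS (Q : groupType) finQ (q : {hom G -> Q}) : T Q finQ (S Q finQ q) =1 q.
  exact: svalP (cid (T_surj Q finQ q)).
have ST (Q : groupType) finQ (p : {hom H -> Q}) : S Q finQ (T Q finQ p) =1 p.
  by apply: T_inj; exact: TS.
have S_nat : natural_transfer S.
  move=> Q R finQ finR p q t qE; apply: (T_inj _ finR _ (t \o S Q finQ p)) => g.
  rewrite TS (T_nat _ _ finQ finR (S Q finQ p) _ t) //=.
  by rewrite TS qE.
pose f : {multiplicative profinite_completion H -> profinite_completion G} :=
  HB.pack (transfer S_nat) (isMultiplicative.Build (profinite_completion H)
    (profinite_completion G) (transfer S_nat) (transferM S_nat)).
exists f, (transfer T_nat); split.
- exact: transferK.
- exact: transferK.
- exact: transfer_continuous.
- exact: transfer_continuous.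
Qed.

End Completion.

(** * Equality of the completions *)

(** The sequences [K] and [C] represent profinite integers, [K] being a unit,
    with K + b C = a.  They are a - b eps and eps, where eps is the profinite
    integer equal to 1 at the primes dividing [a] and to 0 at the others: at a
    prime dividing [a], [K] is congruent to -b, and elsewhere to [a]. *)
Lemma profinite_exponents (a b : nat) : 0 < a -> coprime a b ->
  exists K C : nat -> nat, forall m, 0 < m ->
    [/\ coprime (K m) m, K m + b * C m = a %[mod m] &
      forall n, 0 < n -> m %| n ->
        K n = K m %[mod m] /\ C n = C m %[mod m]].
Proof.
move=> a_gt0 cop_ab.
pose pi := \pi(a).
pose C m := chinese m`_pi m`_pi^' 1 0.
(* Multiplication by [m.-1] changes the sign modulo [m]. *)
pose K m := a + b * (C m * m.-1).
have Cpi m : C m = 1 %[mod m`_pi] by apply: chinese_modl; exact: coprime_partC.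
have Cpi' m : C m = 0 %[mod m`_pi^'] by apply: chinese_modr; exact: coprime_partC.
have mod_dvd d m i j : d %| m -> i = j %[mod m] -> i = j %[mod d].
  by move=> dm ij; rewrite -(modn_dvdm i dm) ij modn_dvdm.
have KC m : 0 < m -> K m + b * C m = a %[mod m].
  move=> m_gt0; rewrite /K -addnA -mulnDr -mulnSr prednK // mulnA.
  by rewrite -modnDmr modnMl addn0.
have CC m n : 0 < m -> 0 < n -> m %| n -> C n = C m %[mod m].
  move=> m_gt0 n_gt0 mn; apply/eqP.
  have := chinese_remainder (coprime_partC pi m m) (C n) (C m).
  rewrite partnC // => ->.
  apply/andP; split; apply/eqP.
    by rewrite Cpi; apply: mod_dvd (Cpi n); exact: partn_dvd.
  by rewrite Cpi'; apply: mod_dvd (Cpi' n); exact: partn_dvd.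
exists K, C => m m_gt0; split; [|exact: KC|].
  rewrite coprime_has_primes //; last by rewrite addn_gt0 a_gt0.
  apply/hasPn => p; rewrite !mem_primes m_gt0 => /andP[p_pr /= p_m].
  rewrite p_pr /=; apply/negP => /andP[_ p_K].
  have := mod_dvd _ _ _ _ p_m (KC m m_gt0).
  rewrite -modnDml (eqP p_K) add0n => bCa.
  move: p_m; rewrite -(partnC pi m_gt0) Euclid_dvdM // => /orP[p_pi|p_pi'].
    have pa : p %| a.
      have : pi.-nat p by apply: pnat_dvd p_pi (part_pnat _ _).
      by rewrite pnatE // mem_primes => /and3P[].
    have pb : p %| b.
      rewrite -[b]muln1 /dvdn -modnMmr -(mod_dvd _ _ _ _ p_pi (Cpi m)) modnMmr.
      by rewrite bCa -/(dvdn p a).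
    have : p %| gcdn a b by rewrite dvdn_gcd pa.
    by rewrite (eqP cop_ab) dvdn1 => /eqP p1; rewrite p1 in p_pr.
  have : p \in pi.
    rewrite mem_primes p_pr a_gt0 /= /dvdn -bCa -modnMmr.
    by rewrite (mod_dvd _ _ _ _ p_pi' (Cpi' m)) modnMmr muln0 mod0n.
  have : pi^'.-nat p by apply: pnat_dvd p_pi' (part_pnat _ _).
  by rewrite pnatE // => /negP.
move=> n n_gt0 mn; split; last exact: CC.
apply/eqP; rewrite -(eqn_modDr (b * C n)) (mod_dvd _ _ _ _ mn (KC n n_gt0)).
by rewrite -modnDmr -modnMmr (CC _ _ m_gt0 n_gt0 mn) modnMmr modnDmr KC.
Qed.

Lemma expg_congr (H : groupType) (x : H) m i j :
  x ^+ m = 1 -> i = j %[mod m] -> x ^+ i = x ^+ j.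
Proof.
move=> xm ij; rewrite (divn_eq i m) (divn_eq j m) ij.
by rewrite !expgnDr ![(_ * m)%N]mulnC !expgnA xm !expg1n.
Qed.

Lemma expg_root (H : groupType) k m : 0 < m -> coprime k m ->
  exists l, forall x : H, x ^+ m = 1 -> (x ^+ k) ^+ l = x.
Proof.
move=> m_gt0 cop_km.
have [l kl] : exists l, k * l = 1 %[mod m].
  have [k0|k_gt0] := posnP k; last first.
    have [u _] := Bezoutl m k_gt0; rewrite (eqP cop_km) => /dvdnP[v uv].
    by exists v; rewrite mulnC -uv -modnDmr modnMl addn0.
  by exists 0; move: cop_km; rewrite k0 /coprime gcd0n => /eqP ->; rewrite !modn1.
by exists l => x xm; rewrite -expgnA (expg_congr xm kl).
Qed.

(** Otherwise the powers of [x] would embed the natural numbers. *)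
Lemma finite_group_torsion (Q : groupType) (x : Q) :
  finite_group Q -> exists2 m, 0 < m & x ^+ m = 1.
Proof.
move=> finQ; apply: contrapT => torsionfree; apply: infinite_nat.
rewrite -(preimage_setT (fun n : nat => x ^+ n)).
apply: finite_preimage => // i j _ _.
wlog le_ij : i j / i <= j.
  by move=> W; case: (leqP i j) => [|/ltnW] ij xij; [exact: W|exact/esym/W].
move=> xij; apply/eqP; rewrite eqn_leq le_ij /= leqNgt; apply/negP => lt_ij.
apply: torsionfree; exists (j - i); first by rewrite subn_gt0.
by rewrite expgnFr // xij mulgV.
Qed.

Lemma hom_tubular_ext (a b : nat) (G Q : groupType) (y x w s : G)
    (p q : {hom G -> Q}) : tubular_presentation a b y x w s ->
  p y = q y -> p x = q x -> p w = q w -> p s = q s -> p =1 q.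
Proof.
move=> G_pres py px pw ps; apply: (tubular_ind G_pres) => // [|g h pg ph|g pg].
- by rewrite !gmulf1.
- by rewrite !gmulfM pg ph.
- by rewrite !gmulfV pg.
Qed.

Section TubularTransfer.
Variables (a b : nat) (a_gt0 : 0 < a) (cop_ab : coprime a b).
Variables (G : groupType) (y x w s : G) (G_pres : tubular_presentation a b y x w s).
Variables (H : groupType) (y' x' w' s' : H).
Hypothesis H_pres : tubular_presentation 1 b y' x' w' s'.

(** The image of [p] under (y, x, w, s) -> (y, x^K, w x^C, s) with profinite
    exponents.  Asking for all exponents [m] of [p x], rather than for its order,
    makes the condition visibly stable under composition of [p] with
    homomorphisms. *)
Definition twisted_by (K C : nat -> nat) (Q : groupType)
    (p : {hom G -> Q}) (q : {hom H -> Q}) : Prop :=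
  [/\ q y' = p y, q s' = p s & forall m, 0 < m -> p x ^+ m = 1 ->
      q x' = p x ^+ K m /\ q w' = p w * p x ^+ C m].

(** (x^K) (w x^C)^b = x^(K + b C) w^b = x^a w^b, so the last relation of [G] for
    (x, w) is the last relation of [H] for (x^K, w x^C); as [K] is a unit, [x]
    and [w] can be recovered from x^K and w x^C. *)
Lemma tubular_profinitely_isomorphic : profinitely_isomorphic G H.
Proof.
have [K [C KC]] := profinite_exponents a_gt0 cop_ab.
have [yx xw vs] := tubular_rel G_pres.
have [yx' xw' vs'] := tubular_rel H_pres.
have twist (Q : groupType) (finQ : finite_group Q) (p : {hom G -> Q}) :
    exists q, twisted_by K C p q.
  have [m m_gt0 pxm] := finite_group_torsion (p x) finQ.
  have [cop_Km KCm KCn] := KC m m_gt0.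
  have pyx := gmulf_commute p yx; have pxw := gmulf_commute p xw.
  have [|q [qy qx qw qs]] := @tubular_lift _ _ _ _ _ _ _ H_pres Q
    (p y) (p x ^+ K m) (p w * p x ^+ C m) (p s).
    split; first exact: commuteX.
      by apply: commuteM; [exact/commute_sym/commuteX/commute_sym|exact: commuteX2].
    rewrite expg1 expgMn; last exact/commuteX/commute_sym.
    have -> : p x ^+ K m * (p w ^+ b * (p x ^+ C m) ^+ b) = p x ^+ a * p w ^+ b.
      rewrite mulgA (commuteX2 (K m) b pxw) -mulgA -expgnA -expgnDr mulnC.
      by rewrite (expg_congr pxm KCm) (commuteX2 a b pxw).
    by rewrite -!gmulfXn -gmulfM; apply: gmulf_commute.
  exists q; split=> // n n_gt0 pxn.
  have [||Kmn Cmn] := KCn (m * n)%N; rewrite ?muln_gt0 ?m_gt0 ?dvdn_mulr //.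
  have [_ _ /(_ (m * n)%N) []] := KC n n_gt0.
  - by rewrite muln_gt0 m_gt0.
  - exact: dvdn_mull.
  move=> Knm Cnm; rewrite qx qw -(expg_congr pxm Kmn) -(expg_congr pxm Cmn).
  by rewrite (expg_congr pxn Knm) (expg_congr pxn Cnm).
pose T : hom_transfer H G := fun Q finQ p => sval (cid (twist Q finQ p)).
have TP (Q : groupType) finQ (p : {hom G -> Q}) : twisted_by K C p (T Q finQ p).
  exact: svalP (cid (twist Q finQ p)).
apply: (@profinitely_isomorphic_of_transfer H G T).
- move=> Q R finQ finR p q t qE.
  have [m m_gt0 pxm] := finite_group_torsion (p x) finQ.
  have [py ps /(_ m m_gt0 pxm) [px pw]] := TP Q finQ p.
  have [qy qs /(_ m m_gt0) []] := TP R finR q.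
    by rewrite qE /= -gmulfXn pxm gmulf1.
  move=> qx qw; apply: (hom_tubular_ext H_pres) => /=.
  + by rewrite qy py qE.
  + by rewrite qx px gmulfXn qE.
  + by rewrite qw pw gmulfM gmulfXn !qE.
  + by rewrite qs ps qE.
- move=> Q finQ p q Tpq.
  have [m m_gt0 pxm] := finite_group_torsion (p x) finQ.
  have [n n_gt0 qxn] := finite_group_torsion (q x) finQ.
  have mn_gt0 : 0 < m * n by rewrite muln_gt0 m_gt0.
  have pxmn : p x ^+ (m * n) = 1 by rewrite expgnA pxm expg1n.
  have qxmn : q x ^+ (m * n) = 1 by rewrite mulnC expgnA qxn expg1n.
  have [py ps /(_ _ mn_gt0 pxmn) [px pw]] := TP Q finQ p.
  have [qy qs /(_ _ mn_gt0 qxmn) [qx qw]] := TP Q finQ q.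
  have [cop_K _ _] := KC _ mn_gt0.
  have [l root] := expg_root Q mn_gt0 cop_K.
  have pqx : p x = q x.
    by rewrite -[p x]root // -[q x]root // -px -qx Tpq.
  apply: (hom_tubular_ext G_pres) => //; rewrite -?py -?ps ?Tpq //.
  by apply: (mulIg (p x ^+ C (m * n)%N)); rewrite -pw Tpq qw pqx.
- move=> Q finQ q.
  have [m m_gt0 qxm] := finite_group_torsion (q x') finQ.
  have [cop_K KCm _] := KC m m_gt0.
  have [l root] := expg_root Q m_gt0 cop_K.
  pose u := q x' ^+ l; pose v := q w' / u ^+ C m.
  have uK : u ^+ K m = q x' by rewrite /u -expgnA mulnC expgnA root.
  have um : u ^+ m = 1 by rewrite /u -expgnA mulnC expgnA qxm expg1n.
  have quw : commute u (q w').
    by apply/commute_sym/commuteX/commute_sym/gmulf_commute.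
  have [|p [py px pw ps]] := @tubular_lift _ _ _ _ _ _ _ G_pres Q (q y') u v (q s').
    split.
    + by apply/commuteX/gmulf_commute.
    + by apply: commuteM => //; apply/commuteV/commuteX.
    have -> : u ^+ a * v ^+ b = q x' * q w' ^+ b.
      rewrite /v expgnFl; last exact/commuteX/commute_sym.
      rewrite mulgA (commuteX2 a b quw) -mulgA -(expg_congr um KCm) expgnDr.
      by rewrite [(b * _)%N]mulnC expgnA mulgK uK -uK (commuteX2 (K m) b quw).
    by rewrite -gmulfXn -gmulfM -[x']expg1; apply: gmulf_commute.
  exists p; have [Ty Ts /(_ m m_gt0)] := TP Q finQ p; rewrite px => /(_ um) [Tx Tw].
  apply: (hom_tubular_ext H_pres).
  + by rewrite Ty py.
  + by rewrite Tx uK.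
  + by rewrite Tw pw /v mulgVK.
  + by rewrite Ts ps.
Qed.

End TubularTransfer.

(** * Commuting pairs in the abelianization *)

Section Heisenberg.
Local Open Scope ring_scope.

(** The triple (p, q, r) is the unitriangular matrix with first row 1, p, r and
    second row 0, 1, q. *)
Definition heisenberg : Type := (int * int * int)%type.
HB.instance Definition _ := Choice.copy heisenberg (int * int * int)%type.

Implicit Types g h : heisenberg.

Definition heisenberg_mul g h : heisenberg :=
  (g.1.1 + h.1.1, g.1.2 + h.1.2, g.2 + h.2 + g.1.1 * h.1.2).
Definition heisenberg_one : heisenberg := (0, 0, 0).
Definition heisenberg_inv g : heisenberg :=
  (- g.1.1, - g.1.2, g.1.1 * g.1.2 - g.2).

Lemma heisenberg_mulA : associative heisenberg_mul.
Proof. by move=> g h k; congr (_, _, _) => /=; ring. Qed.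
Lemma heisenberg_mul1 : left_id heisenberg_one heisenberg_mul.
Proof. by case=> [[p q] r]; congr (_, _, _) => /=; ring. Qed.
Lemma heisenberg_mulr1 : right_id heisenberg_one heisenberg_mul.
Proof. by case=> [[p q] r]; congr (_, _, _) => /=; ring. Qed.
Lemma heisenberg_mulV : left_inverse heisenberg_one heisenberg_inv heisenberg_mul.
Proof. by move=> g; congr (_, _, _) => /=; ring. Qed.
Lemma heisenberg_mulrV : right_inverse heisenberg_one heisenberg_inv heisenberg_mul.
Proof. by move=> g; congr (_, _, _) => /=; ring. Qed.

HB.instance Definition _ := isGroup.Build heisenberg heisenberg_mulA
  heisenberg_mul1 heisenberg_mulr1 heisenberg_mulV heisenberg_mulrV.

Lemma heisenberg_commute g h : commute g h <-> g.1.1 * h.1.2 = h.1.1 * g.1.2.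
Proof.
have mulE u v : (u * v)%g = heisenberg_mul u v by [].
split=> [|gh]; rewrite /commute !mulE /heisenberg_mul.
  by case; rewrite [h.2 + _]addrC => _ _ /addrI.
by rewrite gh ![h.1.1 + _]addrC ![h.1.2 + _]addrC [h.2 + _]addrC.
Qed.

Lemma heisenberg_exp1 g n : (g ^+ n)%g.1.1 = n%:Z * g.1.1.
Proof. by elim: n => [|n IH]; rewrite ?mul0r // expgS /= IH intS; ring. Qed.

Lemma heisenberg_exp2 g n : (g ^+ n)%g.1.2 = n%:Z * g.1.2.
Proof. by elim: n => [|n IH]; rewrite ?mul0r // expgS /= IH intS; ring. Qed.

End Heisenberg.

Definition additive_character (G : groupType) (chi : G -> int) : Prop :=
  {morph chi : g h / g * h >-> (g + h)%R}.

Section Characters.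
Variables (G : groupType) (chi : G -> int) (chiM : additive_character chi).
Local Open Scope ring_scope.

Lemma character1 : chi 1%g = 0.
Proof. by apply: (addrI (chi 1%g)); rewrite -chiM mulg1 addr0. Qed.

Lemma characterV g : chi g^-1%g = - chi g.
Proof. by apply: (addrI (chi g)); rewrite -chiM mulgV character1 subrr. Qed.

Lemma characterX g n : chi (g ^+ n)%g = n%:Z * chi g.
Proof.
by elim: n => [|n IH]; rewrite ?mul0r ?character1 // expgS chiM IH intS; ring.
Qed.

End Characters.

Section TubularCharacters.
Variables (a b : nat) (G : groupType) (y x w s : G).
Hypothesis G_pres : tubular_presentation a b y x w s.
Local Open Scope ring_scope.

(** A homomorphism from [G] to the Heisenberg group is given by two integers for
    each generator, subject to the vanishing of a determinant for each relation;
    it makes that determinant vanish on all commuting pairs. *)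
Lemma heisenberg_characters (ny nx nw ns my mx mw ms : int) :
  ny * mx = nx * my -> nx * mw = nw * mx ->
  (a%:Z * nx + b%:Z * nw) * ms = ns * (a%:Z * mx + b%:Z * mw) ->
  exists alpha beta : G -> int,
    [/\ additive_character alpha, additive_character beta,
        [/\ alpha y = ny, alpha x = nx, alpha w = nw & alpha s = ns],
        [/\ beta y = my, beta x = mx, beta w = mw & beta s = ms] &
        forall g h, commute g h -> alpha g * beta h = alpha h * beta g].
Proof.
move=> yx xw vs.
have [|f [fy fx fw fs]] := @tubular_lift _ _ _ _ _ _ _ G_pres heisenberg
  ((ny, my, 0) : heisenberg) ((nx, mx, 0) : heisenberg)
  ((nw, mw, 0) : heisenberg) ((ns, ms, 0) : heisenberg).
  split; apply/heisenberg_commute => //=.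
  by rewrite !heisenberg_exp1 !heisenberg_exp2.
exists (fun g => (f g).1.1), (fun g => (f g).1.2).
split=> [g h|g h|||g h gh]; rewrite ?fy ?fx ?fw ?fs ?gmulfM //.
exact/heisenberg_commute/gmulf_commute.
Qed.

Lemma character_ext (chi psi : G -> int) :
  additive_character chi -> additive_character psi ->
  chi y = psi y -> chi x = psi x -> chi w = psi w -> chi s = psi s -> chi =1 psi.
Proof.
move=> chiM psiM ey ex ew es; apply: (tubular_ind G_pres) => // [|g h eg eh|g eg].
- by rewrite !character1.
- by rewrite chiM psiM eg eh.
- by rewrite !characterV ?eg.
Qed.

Definition coordinates (cy cx cw cs : G -> int) : Prop :=
  [/\ [/\ additive_character cy, additive_character cx,
          additive_character cw & additive_character cs],
      [/\ cy y = 1, cy x = 0, cy w = 0 & cy s = 0],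
      [/\ cx y = 0, cx x = 1, cx w = 0 & cx s = 0],
      [/\ cw y = 0, cw x = 0, cw w = 1 & cw s = 0] &
      [/\ cs y = 0, cs x = 0, cs w = 0 & cs s = 1]].

Lemma exists_coordinates : exists cy cx cw cs, coordinates cy cx cw cs.
Proof.
have char (ny nx nw ns : int) : exists c : G -> int, additive_character c /\
    [/\ c y = ny, c x = nx, c w = nw & c s = ns].
  have [||| c [_ [cM _ cE _ _]]] := @heisenberg_characters ny nx nw ns 0 0 0 0;
    rewrite ?mulr0 ?addr0 ?mulr0 //.
  by exists c.
have [cy [cyM cyE]] := char 1 0 0 0; have [cx [cxM cxE]] := char 0 1 0 0.
have [cw [cwM cwE]] := char 0 0 1 0; have [cs [csM csE]] := char 0 0 0 1.
by exists cy, cx, cw, cs.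
Qed.

Section Coordinates.
Variables cy cx cw cs : G -> int.
Hypothesis coord : coordinates cy cx cw cs.

Lemma coordinate_expansion (psi : G -> int) : additive_character psi -> forall g,
  psi g = cy g * psi y + cx g * psi x + cw g * psi w + cs g * psi s.
Proof.
have [[cyM cxM cwM csM] [yy yx yw ys] [xy xx xw xs] [wy wx ww ws] [sy sx sw ss]]
  := coord.
move=> psiM; apply: character_ext => // [g h||||].
- by rewrite cyM cxM cwM csM; ring.
- by rewrite yy xy wy sy; ring.
- by rewrite yx xx wx sx; ring.
- by rewrite yw xw ww sw; ring.
- by rewrite ys xs ws ss; ring.
Qed.

(** The bivectors y /\ x, x /\ w and (a x + b w) /\ s of the relations are
    annihilated by dy /\ dw, dy /\ ds and (b dx - a dw) /\ ds, and these three
    forms are decomposable, so each is the commutator form of a homomorphism to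
    the Heisenberg group. *)
Lemma commuting_coordinates g h : commute g h ->
  [/\ cy g * cw h = cy h * cw g, cy g * cs h = cy h * cs g &
      (b%:Z * cx g - a%:Z * cw g) * cs h = (b%:Z * cx h - a%:Z * cw h) * cs g].
Proof.
have [[cyM cxM cwM csM] [yy yx yw ys] [xy xx xw xs] [wy wx ww ws] [sy sx sw ss]]
  := coord.
move=> gh; split.
- have [|||al [be [alM beM [ay ax aw as_] [by_ bx bw bs] comm]]] :=
    @heisenberg_characters 1 0 0 0 0 0 1 0; try by ring.
  have ealy : al =1 cy.
    by apply: character_ext => //; rewrite ?(ay, ax, aw, as_, yy, yx, yw, ys).
  have ebe : be =1 cw.
    by apply: character_ext => //; rewrite ?(by_, bx, bw, bs, wy, wx, ww, ws).
  by rewrite -!ealy -!ebe; exact: comm.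
- have [|||al [be [alM beM [ay ax aw as_] [by_ bx bw bs] comm]]] :=
    @heisenberg_characters 1 0 0 0 0 0 0 1; try by ring.
  have ealy : al =1 cy.
    by apply: character_ext => //; rewrite ?(ay, ax, aw, as_, yy, yx, yw, ys).
  have ebe : be =1 cs.
    by apply: character_ext => //; rewrite ?(by_, bx, bw, bs, sy, sx, sw, ss).
  by rewrite -!ealy -!ebe; exact: comm.
- have [|||al [be [alM beM [ay ax aw as_] [by_ bx bw bs] comm]]] :=
    @heisenberg_characters 0 b%:Z (- a%:Z) 0 0 0 0 1; try by ring.
  have eal : al =1 (fun g => b%:Z * cx g - a%:Z * cw g).
    by move=> k; rewrite (coordinate_expansion alM) ay ax aw as_; ring.
  have ebe : be =1 cs.
    by apply: character_ext => //; rewrite ?(by_, bx, bw, bs, sy, sx, sw, ss).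
  by rewrite -!eal -!ebe; exact: comm.
Qed.

End Coordinates.

End TubularCharacters.

(** * Recovering the two lines *)

Section LinearAlgebra.
Local Open Scope ring_scope.

Lemma coprime_bezout (c d : nat) : coprime c d ->
  exists u v : int, u * c%:Z + v * d%:Z = 1.
Proof.
move=> cd; have [u [v uv]] := Bezoutz c%:Z d%:Z.
by exists u, v; rewrite uv /gcdz !absz_nat (eqP cd).
Qed.

Lemma unit_divisor (n m : int) : n * m = 1 -> n = 1 \/ n = - 1.
Proof.
move=> nm; have : (`|n| * `|m|)%N = 1%N by rewrite -abszM nm.
by move=> /eqP; rewrite muln_eq1 => /andP[/eqP n1 _]; lia.
Qed.

(** The vectors are written in the coordinates y, x, w, s.  If [(p, q, r, t)] is
    on neither of the lines spanned by (0, 1, 0, 0) and (0, a, b, 0), then the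
    vectors that the three forms pair with it to zero span a plane, which has
    no room for it and two further independent vectors. *)
Lemma large_centralizer_line (a b p q r t p1 q1 r1 t1 p2 q2 r2 t2 : int) :
  b != 0 ->
  [/\ p * r1 = p1 * r, p * t1 = p1 * t &
      (b * q - a * r) * t1 = (b * q1 - a * r1) * t] ->
  [/\ p * r2 = p2 * r, p * t2 = p2 * t &
      (b * q - a * r) * t2 = (b * q2 - a * r2) * t] ->
  (forall k k1 k2 : int,
    k * p + k1 * p1 + k2 * p2 = 0 -> k * q + k1 * q1 + k2 * q2 = 0 ->
    k * r + k1 * r1 + k2 * r2 = 0 -> k * t + k1 * t1 + k2 * t2 = 0 ->
    [/\ k = 0, k1 = 0 & k2 = 0]) ->
  [/\ p = 0, t = 0 & r = 0 \/ b * q = a * r].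
Proof.
move=> b0 [pr1 pt1 lt1] [pr2 pt2 lt2] indep.
have p0 : p = 0.
  apply/eqP/negPn/negP => p0.
  have rt1 : r * t1 - r1 * t = 0.
    apply: (mulfI p0).
    have -> : p * (r * t1 - r1 * t) = r * (p * t1 - p1 * t) - t * (p * r1 - p1 * r).
      by ring.
    by rewrite pt1 pr1; ring.
  have qt1 : q * t1 - q1 * t = 0.
    apply: (mulfI b0).
    have -> : b * (q * t1 - q1 * t) = ((b * q - a * r) * t1 - (b * q1 - a * r1) * t)
        + a * (r * t1 - r1 * t) by ring.
    by rewrite lt1 rt1; ring.
  have [t0|t0] := eqVneq t 0; last first.
    have [||||_ /eqP + _] := indep t1 (- t) 0; last by rewrite oppr_eq0 (negPf t0).
    - have -> : t1 * p + - t * p1 + 0 * p2 = p * t1 - p1 * t by ring.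
      by rewrite pt1 subrr.
    - by rewrite -[RHS]qt1; ring.
    - by rewrite -[RHS]rt1; ring.
    - by ring.
  have t10 : t1 = 0 by apply: (mulfI p0); rewrite pt1 t0; ring.
  have t20 : t2 = 0 by apply: (mulfI p0); rewrite pt2 t0; ring.
  (* Up to multiples of [(p, q, r, t)], both vectors lie on the line of x. *)
  pose d1 := p * q1 - p1 * q; pose d2 := p * q2 - p2 * q.
  have [||||_ d2p d1p] := indep (d1 * p2 - d2 * p1) (d2 * p) (- (d1 * p)).
  - by ring.
  - by rewrite /d1 /d2; ring.
  - have -> : (d1 * p2 - d2 * p1) * r + d2 * p * r1 + - (d1 * p) * r2
        = d2 * (p * r1 - p1 * r) - d1 * (p * r2 - p2 * r) by ring.
    by rewrite pr1 pr2; ring.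
  - by rewrite t0 t10 t20; ring.
  have d10 : d1 = 0 by apply: (mulIf p0); rewrite mul0r; apply: oppr_inj; rewrite oppr0.
  have [||||_ /eqP + _] := indep p1 (- p) 0; last by rewrite oppr_eq0 (negPf p0).
  - by ring.
  - by have -> : p1 * q + - p * q1 + 0 * q2 = - d1; [rewrite /d1; ring|rewrite d10 oppr0].
  - have -> : p1 * r + - p * r1 + 0 * r2 = - (p * r1 - p1 * r) by ring.
    by rewrite pr1 subrr oppr0.
  - by rewrite t0 t10; ring.
have t0 : t = 0.
  apply/eqP/negPn/negP => t0.
  have p10 : p1 = 0 by apply: (mulIf t0); rewrite -pt1 p0; ring.
  have p20 : p2 = 0 by apply: (mulIf t0); rewrite -pt2 p0; ring.
  (* Up to multiples of [(p, q, r, t)], both vectors lie on the line of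
     (0, a, b, 0). *)
  pose Q1 := t * q1 - t1 * q; pose R1 := t * r1 - t1 * r.
  pose Q2 := t * q2 - t2 * q; pose R2 := t * r2 - t2 * r.
  have QR1 : b * Q1 = a * R1.
    apply/eqP; rewrite -subr_eq0.
    have -> : b * Q1 - a * R1 = (b * q1 - a * r1) * t - (b * q - a * r) * t1.
      by rewrite /Q1 /R1; ring.
    by rewrite lt1 subrr.
  have QR2 : b * Q2 = a * R2.
    apply/eqP; rewrite -subr_eq0.
    have -> : b * Q2 - a * R2 = (b * q2 - a * r2) * t - (b * q - a * r) * t2.
      by rewrite /Q2 /R2; ring.
    by rewrite lt2 subrr.
  have [||||_ R2t R1t] := indep (R1 * t2 - R2 * t1) (R2 * t) (- (R1 * t)).
  - by rewrite p0 p10 p20; ring.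
  - apply: (mulfI b0).
    have -> : b * ((R1 * t2 - R2 * t1) * q + R2 * t * q1 + - (R1 * t) * q2)
        = R2 * (b * Q1) - R1 * (b * Q2) by rewrite /Q1 /Q2; ring.
    by rewrite QR1 QR2; ring.
  - by rewrite /R1 /R2; ring.
  - by ring.
  have R10 : R1 = 0 by apply: (mulIf t0); rewrite mul0r; apply: oppr_inj; rewrite oppr0.
  have Q10 : Q1 = 0 by apply: (mulfI b0); rewrite QR1 R10; ring.
  have [||||_ /eqP + _] := indep (- t1) t 0; last by rewrite (negPf t0).
  - by rewrite p0 p10; ring.
  - by rewrite -[RHS]Q10 /Q1; ring.
  - by rewrite -[RHS]R10 /R1; ring.
  - by ring.
split=> //; have [->|r0] := eqVneq r 0; first by left.
right; apply/eqP/negPn/negP => l0.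
have {}l0 : b * q - a * r != 0 by rewrite subr_eq0.
have p10 : p1 = 0 by apply: (mulIf r0); rewrite -pr1 p0; ring.
have p20 : p2 = 0 by apply: (mulIf r0); rewrite -pr2 p0; ring.
have t10 : t1 = 0 by apply: (mulfI l0); rewrite lt1 t0; ring.
have t20 : t2 = 0 by apply: (mulfI l0); rewrite lt2 t0; ring.
(* Now all three vectors lie in the plane spanned by x and w. *)
have [||||_ _ qr1] := indep (q1 * r2 - q2 * r1) (q2 * r - q * r2) (q * r1 - q1 * r).
- by rewrite p0 p10 p20; ring.
- by ring.
- by ring.
- by rewrite t0 t10 t20; ring.
have [||||_ /eqP + _] := indep r1 (- r) 0; last by rewrite oppr_eq0 (negPf r0).
- by rewrite p0 p10; ring.
- by rewrite -[RHS]qr1; ring.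
- by ring.
- by rewrite t0 t10; ring.
Qed.

End LinearAlgebra.

Section TubularIsomorphism.
Variables (a a' b : nat) (cop_ab : coprime a b) (cop_a'b : coprime a' b).
Hypothesis b_gt0 : (0 < b)%N.
Variables (G : groupType) (y x w s : G).
Hypothesis G_pres : tubular_presentation a b y x w s.
Variables (G' : groupType) (y' x' w' s' : G').
Hypothesis G'_pres : tubular_presentation a' b y' x' w' s'.
Local Open Scope ring_scope.

(** [x] commutes with [y] and [w], and v = x^a w^b commutes with [x] and [s], so
    the images of [x] and [v] lie on the two special lines of [G'].  They are
    independent, hence on different lines, and primitive, hence generators
    e x' and l v' in one of the two orders.  Reading the x'-coordinate of
    v = a x + b w gives the first congruence if the order is kept and the second
    if it is reversed. *)
Lemma tubular_isomorphic : isomorphic G G' ->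
  exists k e : int, (e = 1 \/ e = - 1) /\
    (a'%:Z = e * a%:Z + k * b%:Z \/ a%:Z * a'%:Z = e + k * b%:Z).
Proof.
move=> [f [f' fK f'K]].
have [cy [cx [cw [cs coord]]]] := exists_coordinates G_pres.
have [ky [kx [kw [ks coord']]]] := exists_coordinates G'_pres.
have [[cyM cxM cwM csM] [yy yx yw ys] [xy xx xw xs] [wy wx ww ws] [sy sx sw ss]]
  := coord.
have [[kyM kxM kwM ksM] _ _ _ _] := coord'.
have [yx_comm xw_comm vs_comm] := tubular_rel G_pres.
set v := (x ^+ a * w ^+ b)%g in vs_comm.
have fM : {morph f : g h / (g * h)%g} by exact: gmulfM.
have f'M : {morph f' : g h / (g * h)%g}.
  by move=> g h; rewrite -[g in LHS]f'K -[h in LHS]f'K -fM fK.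
have cV chi : additive_character chi -> chi v = a%:Z * chi x + b%:Z * chi w.
  by move=> chiM; rewrite /v chiM !characterX.
have kV chi : additive_character chi -> chi (f v) = a%:Z * chi (f x) + b%:Z * chi (f w).
  move=> chiM; pose phi g := chi (f g).
  have phiM : additive_character phi by move=> g h; rewrite /phi fM chiM.
  exact: cV phiM.
have expand chi g : additive_character chi ->
    chi g = ky (f g) * chi (f' y') + kx (f g) * chi (f' x')
          + kw (f g) * chi (f' w') + ks (f g) * chi (f' s').
  move=> chiM; have phiM : additive_character (chi \o f').
    by move=> g1 g2; rewrite /= f'M chiM.
  by rewrite -[g in LHS]fK; exact: (coordinate_expansion G'_pres coord' phiM).
(* Linear relations between images under [f] pull back, because every character
   of [G] is an integral combination of the coordinates of [G'] composed with [f]. *)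
have transfer_relation (k k1 k2 : int) g g1 g2 :
    k * ky (f g) + k1 * ky (f g1) + k2 * ky (f g2) = 0 ->
    k * kx (f g) + k1 * kx (f g1) + k2 * kx (f g2) = 0 ->
    k * kw (f g) + k1 * kw (f g1) + k2 * kw (f g2) = 0 ->
    k * ks (f g) + k1 * ks (f g1) + k2 * ks (f g2) = 0 ->
    forall chi, additive_character chi -> k * chi g + k1 * chi g1 + k2 * chi g2 = 0.
  move=> ry rx rw rs chi chiM.
  rewrite (expand chi g chiM) (expand chi g1 chiM) (expand chi g2 chiM).
  transitivity ((k * ky (f g) + k1 * ky (f g1) + k2 * ky (f g2)) * chi (f' y')
    + (k * kx (f g) + k1 * kx (f g1) + k2 * kx (f g2)) * chi (f' x')
    + (k * kw (f g) + k1 * kw (f g1) + k2 * kw (f g2)) * chi (f' w')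
    + (k * ks (f g) + k1 * ks (f g1) + k2 * ks (f g2)) * chi (f' s')).
    by ring.
  by rewrite ry rx rw rs; ring.
have b0 : b%:Z != 0 by lia.
have comm g h : commute g h -> commute (f g) (f h).
  by move=> gh; rewrite /commute -!fM gh.
have vx_comm : commute v x.
  by apply/commute_sym/commuteM; apply: commuteX.
have indep_v (k k1 k2 : int) :
    k * ky (f v) + k1 * ky (f x) + k2 * ky (f s) = 0 ->
    k * kx (f v) + k1 * kx (f x) + k2 * kx (f s) = 0 ->
    k * kw (f v) + k1 * kw (f x) + k2 * kw (f s) = 0 ->
    k * ks (f v) + k1 * ks (f x) + k2 * ks (f s) = 0 ->
    [/\ k = 0, k1 = 0 & k2 = 0].
  move=> ry rx rw rs; have rel := transfer_relation _ _ _ _ _ _ ry rx rw rs.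
  have k0 : k = 0.
    apply: (mulIf b0); have := rel cw cwM.
    by rewrite (cV _ cwM) wx ww ws mul0r => <-; ring.
  split=> //.
    by have := rel cx cxM; rewrite k0 xx xs => <-; ring.
  by have := rel cs csM; rewrite k0 sx ss => <-; ring.
have [kyx ksx line_x] : [/\ ky (f x) = 0, ks (f x) = 0 &
    kw (f x) = 0 \/ b%:Z * kx (f x) = a'%:Z * kw (f x)].
  apply: (large_centralizer_line (b := b%:Z) b0
    (commuting_coordinates G'_pres coord' (comm _ _ (commute_sym yx_comm)))
    (commuting_coordinates G'_pres coord' (comm _ _ xw_comm))).
  move=> k k1 k2 ry rx rw rs; have rel := transfer_relation _ _ _ _ _ _ ry rx rw rs.
  split.
  - by have := rel cx cxM; rewrite xx xy xw => <-; ring.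
  - by have := rel cy cyM; rewrite yx yy yw => <-; ring.
  - by have := rel cw cwM; rewrite wx wy ww => <-; ring.
have [kyv ksv line_v] : [/\ ky (f v) = 0, ks (f v) = 0 &
    kw (f v) = 0 \/ b%:Z * kx (f v) = a'%:Z * kw (f v)].
  exact: (large_centralizer_line (b := b%:Z) b0
    (commuting_coordinates G'_pres coord' (comm _ _ vx_comm))
    (commuting_coordinates G'_pres coord' (comm _ _ vs_comm)) indep_v).
have [u [u' uu']] := coprime_bezout cop_a'b.
have [m [m' mm']] := coprime_bezout cop_ab.
have multiple (q r : int) : b%:Z * q = a'%:Z * r ->
    exists n, q = n * a'%:Z /\ r = n * b%:Z.
  move=> qr; exists (u * q + u' * r); split.
    have -> : (u * q + u' * r) * a'%:Z = (u * a'%:Z) * q + u' * (a'%:Z * r) by ring.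
    by rewrite -qr -[LHS]mul1r -uu'; ring.
  have -> : (u * q + u' * r) * b%:Z = u * (b%:Z * q) + (u' * b%:Z) * r by ring.
  by rewrite qr -[LHS]mul1r -uu'; ring.
(* Primitivity of the images of [x] and [v]: a functional taking the value 1 on
   them is pulled back along the inverse isomorphism. *)
have xE : 1 = kx (f x) * cx (f' x') + kw (f x) * cx (f' w').
  by rewrite -xx (expand cx x cxM) kyx ksx; ring.
have vE : 1 = kx (f v) * (m * cx (f' x') + m' * cw (f' x'))
            + kw (f v) * (m * cx (f' w') + m' * cw (f' w')).
  have : m * cx v + m' * cw v = 1.
    by rewrite !cV // xx xw wx ww -[RHS]mm'; ring.
  by rewrite (expand cx v cxM) (expand cw v cwM) kyv ksv => <-; ring.
case: line_x => [kwx|/multiple[n [kxx kwx]]];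
  case: line_v => [kwv|/multiple[l [kxv kwv]]].
- have [||||kx0 _ _] := indep_v (kx (f x)) (- kx (f v)) 0.
  + by rewrite kyv kyx; ring.
  + by ring.
  + by rewrite kwv kwx; ring.
  + by rewrite ksv ksx; ring.
  by move: xE; rewrite kx0 kwx; lia.
- have e1 : kx (f x) = 1 \/ kx (f x) = - 1.
    by apply: (@unit_divisor _ (cx (f' x'))); rewrite xE kwx; ring.
  have l1 : l = 1 \/ l = - 1.
    apply: (unit_divisor (m := a'%:Z * (m * cx (f' x') + m' * cw (f' x'))
      + b%:Z * (m * cx (f' w') + m' * cw (f' w')))).
    by rewrite vE kxv kwv; ring.
  have := kV kx kxM; rewrite kxv => la'.
  exists (l * kx (f w)), (l * kx (f x)); split; first by lia.
  left; have ll : l * l = 1 by case: l1 => ->.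
  by rewrite -[LHS]mul1r -ll -mulrA la'; ring.
- have e1 : kx (f v) = 1 \/ kx (f v) = - 1.
    apply: (unit_divisor (m := m * cx (f' x') + m' * cw (f' x'))).
    by rewrite vE kwv; ring.
  have n1 : n = 1 \/ n = - 1.
    apply: (unit_divisor (m := a'%:Z * cx (f' x') + b%:Z * cx (f' w'))).
    by rewrite xE kxx kwx; ring.
  have := kV kx kxM; rewrite kxx => va'.
  exists (- n * kx (f w)), (n * kx (f v)); split; first by lia.
  right; have nn : n * n = 1 by case: n1 => ->.
  by rewrite va' -[LHS]mul1r -nn; ring.
- have [||||n0 _ _] := indep_v n (- l) 0.
  + by rewrite kyv kyx; ring.
  + by rewrite kxv kxx; ring.
  + by rewrite kwv kwx; ring.
  + by rewrite ksv ksx; ring.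
  by move: xE; rewrite kxx kwx n0; lia.
Qed.

End TubularIsomorphism.

(** * The genus *)

Lemma isomorphic_refl (G : groupType) : isomorphic G G.
Proof. by exists idfun; exists idfun. Qed.

Lemma small_multiple (z k b : int) :
  (z = k * b -> - b < z -> z < b -> z = 0)%R.
Proof.
move=> zkb lb ub; have [k0|[k1|k1]] : (k = 0 \/ 1 <= k \/ k <= -1)%R by lia.
- by rewrite zkb k0 mul0r.
- by nia.
- by nia.
Qed.

Theorem mainTheorem2 (N : nat) :
  exists G : groupType,
    free_by_cyclic G /\ card_larger_than N (profinite_genus G).
Proof.
(* [b] exceeds every a + a' and a a' + 1 with a, a' at most N + 1. *)
have [b b_large b_pr] := prime_above ((N.+1 ^ 2).+1)%N.
have b_gt0 := prime_gt0 b_pr.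
have cop_b (i : 'I_N.+1) : coprime i.+1 b.
  rewrite coprime_sym prime_coprime //; apply/negP => /dvdn_leq.
  by have := ltn_ord i; nia.
pose G (i : 'I_N.+1) := tubular_group b (ltn0Sn i).
have G_pres i := tubular_groupP b (ltn0Sn i).
exists (G ord0); split; first exact: tubular_free_by_cyclic.
exists (fun i => isomorphic (G i)); split=> [i j ij|i].
  have : isomorphic (G i) (G j) by rewrite ij; exact: isomorphic_refl.
  case/(tubular_isomorphic (cop_b i) (cop_b j) b_gt0 (G_pres i) (G_pres j)).
  move=> k [e [e1 eqs]]; apply/val_inj => /=.
  have := ltn_ord i; have := ltn_ord j; move: b_large e1 eqs => /=.
  move: (nat_of_ord i) (nat_of_ord j) => p q b_large e1 eqs qN pN.
  have b_bound : ((N.+1)%:R * (N.+1)%:R + 1 < b%:R :> int)%R by nia.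
  case: eqs => E.
    have z : (q.+1%:Z - e * p.+1%:Z = 0)%R.
      by apply: (@small_multiple _ k b); [rewrite E; ring| |]; case: e1 => ->; nia.
    by case: e1 z => ->; lia.
  have z : (p.+1%:Z * q.+1%:Z - e = 0)%R.
    by apply: (@small_multiple _ k b); [rewrite E; ring| |]; case: e1 => ->; nia.
  by case: e1 z => ->; nia.
exists (G i); split=> //; first exact: tubular_free_by_cyclic.
exact: (tubular_profinitely_isomorphic (ltn0Sn i) (cop_b i) (G_pres i) (G_pres ord0)).
Qed.
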